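(* Let $p$ be an odd prime and let $e$ be a positive integer. Then the largest complexity of a skew morphism of $\mathbb{Z}_{p^e}$ is $2e-1$.
   Context: $\mathbb{Z}_n$ is the cyclic group of integers modulo $n$. A skew morphism of a finite group $G$ is a permutation $\varphi$ of $G$ fixing the identity such that for each $a\in G$ there is a non-negative integer $i_a$ with $\varphi(ab)=\varphi(a)\varphi^{i_a}(b)$ for all $b\in G$. ${\rm ord}(\varphi)$ is the order of $\langle\varphi\rangle$. If $\varphi$ is non-trivial, $\pi_\varphi(a)$ is the unique such $i_a\in\{1,\dots,{\rm ord}(\varphi)-1\}$; if $\varphi$ is the identity, $\pi_\varphi(a)=1$. Let $\sigma_\varphi(x,y)=\sum_{i=0}^{x-1}\pi_\varphi(\varphi^i(y))\in\mathbb{Z}_{{\rm ord}(\varphi)}$. The derived skew morphism $\varphi'$ of a skew morphism $\varphi$ of $\mathbb{Z}_n$ is the skew morphism of $\mathbb{Z}_{{\rm ord}(\varphi)}$ given by $\varphi'(a)=\sigma_\varphi(a,1)$. Set $\varphi^{(0)}=\varphi$, $\varphi^{(i+1)}=(\varphi^{(i)})'$. For $n\ge 2$ the complexity of $\varphi$ is the unique non-negative integer $c$ such that $\varphi^{(c)}$ is a skew morphism of a non-trivial cyclic group and $\varphi^{(c+1)}$ is a skew morphism of $\mathbb{Z}_1$. *)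

(* Defs.v *)
From mathcomp Require Import all_boot all_order all_fingroup.
Set Implicit Arguments. Unset Strict Implicit. Unset Printing Implicit Defensive.

(* Z_n is represented by 'I_n (residues 0..n-1), with addition modulo n.
   The element a itself serves as default (n > 0 since 'I_n is inhabited),
   so addI a b has value (a + b) %% n exactly. *)
Definition addI (n : nat) (a b : 'I_n) : 'I_n := insubd a ((a + b) %% n).

Definition skew_morphism (n : nat) (s : {perm 'I_n}) : Prop :=
  (forall a : 'I_n, val a = 0 -> s a = a) /\
  (forall a : 'I_n, exists i : nat,
     forall b : 'I_n, s (addI a b) = addI (s a) ((s ^+ i)%g b)).

(* pi_phi(a): 1 if phi is the identity, otherwise the (unique) i in
   {1, ..., ord(phi)-1} with phi(a+b) = phi(a) + phi^i(b) for all b. *)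
Definition skew_pi (n : nat) (s : {perm 'I_n}) (a : 'I_n) : nat :=
  if #[s]%g == 1 then 1
  else (find (fun i => [forall b : 'I_n,
                 s (addI a b) == addI (s a) ((s ^+ i.+1)%g b)])
             (iota 0 (#[s]%g).-1)).+1.

Definition skew_sigma (n : nat) (s : {perm 'I_n}) (x : nat) (y : 'I_n) : nat :=
  (\sum_(i < x) skew_pi s ((s ^+ i)%g y)) %% #[s]%g.

(* the element 1 of Z_n (n >= 1); None only for the empty 'I_0 *)
Definition oneZ (n : nat) : option 'I_n := insub (1 %% n).

Definition derived_fun (n : nat) (s : {perm 'I_n}) (a : 'I_(#[s]%g)) : 'I_(#[s]%g) :=
  if oneZ n is Some one then insubd a (skew_sigma s a one) else a.
Arguments derived_fun n s a : clear implicits.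

(* The derived skew morphism as a permutation of Z_{ord(phi)}.  For a skew
   morphism phi, derived_fun is a permutation (it is a skew morphism), so
   the fallback branch is never used for skew morphisms. *)
Definition derived (n : nat) (s : {perm 'I_n}) : {perm 'I_(#[s]%g)} :=
  match injectiveP (derived_fun n s) with
  | ReflectT H => perm H
  | ReflectF _ => 1%g
  end.
Arguments derived n s : clear implicits.

Definition skm := {n : nat & {perm 'I_n}}.
Definition derivedS (x : skm) : skm := existT _ #[projT2 x]%g (derived _ (projT2 x)).

Definition iter_derived (n : nat) (s : {perm 'I_n}) (k : nat) : skm :=
  iter k derivedS (existT _ n s).

Definition complexity (n : nat) (s : {perm 'I_n}) (c : nat) : Prop :=
  2 <= projT1 (iter_derived s c) /\ projT1 (iter_derived s c.+1) = 1.

(* Main.v *)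
Require Import Defs.
From mathcomp Require Import all_boot all_order all_fingroup.
From mathcomp Require Import all_algebra cyclic ring zify.
Set Implicit Arguments. Unset Strict Implicit. Unset Printing Implicit Defensive.
Import GRing.Theory Num.Theory.

(** Write [t] for the translation [x |-> x + 1] of Z_n. A permutation [s] fixing 0
    is a skew morphism iff [<t><s>] is a group; then [<t>] is regular and [<s>] is the
    stabiliser of 0. The derived morphism is the action of [t] on the cosets of
    [<t>], identified with Z_{ord s}; hence its order divides [n], and [ord s < n]
    for [n > 1] since the stabiliser of 1 in [<s>] is trivial. So deriving twice
    sends Z_{p^i} to some Z_{p^j} with [j < i], which gives the upper bound.

    For the lower bound let the affine maps act on Z/p^e, put [q = 1 + p] and
    [g = p - 1], and factor the group generated by [z |-> q z + 1] (regular)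
    and [z |-> g z] (stabiliser of 0). The resulting skew morphism satisfies
    [q^(s x) = 1 + g (q^x - 1)] modulo [p^(e+1)], and deriving twice yields the
    same formula with [e] replaced by [e - 1]. *)

(** * Skew morphisms and their derived morphisms through products of permutations *)

Section Translation.
Variable n : nat.
Implicit Types (a b : 'I_n) (s : {perm 'I_n}).

(* The argument only witnesses that 'I_n is inhabited. *)
Definition zeroI a : 'I_n := insubd a 0.

Lemma ord_gt0 a : 0 < n. Proof. exact: leq_ltn_trans (ltn_ord a). Qed.

Lemma val_addI a b : addI a b = (a + b) %% n :> nat.
Proof. by rewrite val_insubd ltn_pmod // (ord_gt0 a). Qed.

Lemma val_zeroI a : zeroI a = 0 :> nat.
Proof. by rewrite val_insubd (ord_gt0 a). Qed.

Lemma translation_inj : injective (fun a : 'I_n => insubd a (a.+1 %% n)).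
Proof.
move=> a b /(congr1 (@nat_of_ord _)); rewrite !val_insubd !ltn_pmod ?(ord_gt0 a) //.
rewrite -[a.+1]addn1 -[b.+1]addn1 => /eqP; rewrite eqn_modDr !modn_small //.
move/eqP.
exact: ord_inj.
Qed.

Definition translation : {perm 'I_n} := perm translation_inj.
Local Notation t := translation.

Lemma val_translationX k a : (t ^+ k)%g a = (a + k) %% n :> nat.
Proof.
elim: k => [|k IHk]; first by rewrite perm1 addn0 modn_small.
rewrite expgSr permM permE val_insubd ltn_pmod ?(ord_gt0 a) //.
by rewrite IHk -addn1 modnDml addn1 addnS.
Qed.

Lemma addI_translation a b : addI a b = (t ^+ a)%g b.
Proof. by apply: ord_inj; rewrite val_addI val_translationX addnC. Qed.

Lemma translationX_mod k : (t ^+ (k %% n) = t ^+ k)%g.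
Proof.
by apply/permP=> a; apply: ord_inj; rewrite !val_translationX modnDmr.
Qed.

Lemma translation_order : (t ^+ n = 1)%g.
Proof. by rewrite -translationX_mod modnn expg0. Qed.

Lemma fix_zeroX s a k : s (zeroI a) = zeroI a -> (s ^+ k)%g (zeroI a) = zeroI a.
Proof. by move=> s0; elim: k => [|k IH]; rewrite ?perm1 // expgSr permM IH. Qed.

Lemma translation_fix0 k a : (t ^+ k)%g (zeroI a) = zeroI a -> (t ^+ k = 1)%g.
Proof.
move/(congr1 (@nat_of_ord _)); rewrite val_translationX !val_zeroI add0n => k0.
by rewrite -translationX_mod k0 expg0.
Qed.

Lemma skew_zero s a : skew_morphism s -> s (zeroI a) = zeroI a.
Proof. by case=> s0 _; apply/s0/val_zeroI. Qed.

(** The defining identity as an equality of permutations; since products act from left to right,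
    evaluating both sides at [b] gives it back. *)
Lemma skew_commute s : skew_morphism s ->
  forall a, exists i, (t ^+ a * s = s ^+ i * t ^+ s a)%g.
Proof.
move=> [_ skew_s] a; have [i Hi] := skew_s a; exists i; apply/permP=> b.
by rewrite !permM -!addI_translation Hi.
Qed.

Lemma skew_commuteX s : skew_morphism s ->
  forall x a, exists i, (t ^+ a * s ^+ x = s ^+ i * t ^+ (s ^+ x)%g a)%g.
Proof.
move=> sk; elim=> [|x IHx] a; first by exists 0; rewrite !expg0 perm1 mulg1 mul1g.
have [i Hi] := IHx a; have [j Hj] := skew_commute sk ((s ^+ x)%g a).
exists (i + j); rewrite expgSr mulgA Hi -mulgA Hj mulgA -expgD.
by rewrite permM.
Qed.

(* The two factors of an element of <s><t> are unique, because <s> fixes 0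
   while <t> acts regularly. *)
Lemma factor_uniq s i j c c' : 0 < n -> skew_morphism s ->
  (s ^+ i * t ^+ c = s ^+ j * t ^+ c' -> s ^+ i = s ^+ j)%g.
Proof.
move=> n0 sk E; pose z : 'I_n := Ordinal n0.
have Ec : (t ^+ c = t ^+ c')%g.
  have := congr1 (fun f : {perm _} => nat_of_ord (f (zeroI z))) E.
  rewrite /= !permM !(@fix_zeroX s) ?(skew_zero z sk) // !val_translationX !val_zeroI !add0n.
  by move=> Em; rewrite -translationX_mod Em translationX_mod.
by move: E; rewrite Ec => /mulIg.
Qed.

(** For non-trivial [s] the search in [skew_pi] covers only the positive exponents below the order,
    so the exponent of [skew_commute] must be shown non-zero modulo the order. *)
Lemma skew_piP s a : skew_morphism s ->
  (t ^+ a * s = s ^+ skew_pi s a * t ^+ s a)%g.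
Proof.
move=> sk; rewrite /skew_pi; case: eqP => [/eqP|/eqP].
  by rewrite order_eq1 => /eqP ->; rewrite perm1 mulg1 expg1 mul1g.
move=> s1; have [i Hi] := skew_commute sk a.
set P := (X in find X); set r := iota _ _.
have hasP : has P r.
  (* The predecessor is taken because the predicate at [i] tests the exponent [i.+1]. *)
  apply/hasP; exists (i %% #[s]%g).-1; last first.
    apply/forallP => b; rewrite !addI_translation -permM Hi permM.
    suff /prednK -> : 0 < i %% #[s]%g by rewrite expg_mod_order.
    (* With exponent 0, [s] would be a power of [t] fixing 0, hence trivial. *)
    rewrite lt0n; apply: contra s1 => /eqP i0.
    move: Hi; rewrite -(expg_mod_order s i) i0 expg0 mul1g => Hi.
    have Ht : (s = t ^+ (n - a + s a))%g.
      by rewrite expgD -Hi mulgA -expgD subnK ?translation_order ?mul1g // ltnW.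
    have : (t ^+ (n - a + s a))%g (zeroI a) = zeroI a by rewrite -Ht (skew_zero a).
    by move/translation_fix0 => E; rewrite order_eq1 Ht E.
  rewrite mem_iota leq0n add0n; move: s1 (order_gt0 s) (ltn_pmod i (order_gt0 s)).
  case: #[s]%g => [|[|m]] //= _ _; case: (_ %% _) => [|k] //=; lia.
have /forallP HP := nth_find 0 hasP; apply/permP => b.
move: (HP b); rewrite nth_iota; last by rewrite -(size_iota 0 (#[s]%g).-1) -has_find.
by rewrite add0n !permM -!addI_translation => /eqP.
Qed.

Lemma skew_sigmaP s x a : skew_morphism s ->
  (t ^+ a * s ^+ x = s ^+ skew_sigma s x a * t ^+ (s ^+ x)%g a)%g.
Proof.
move=> sk; rewrite /skew_sigma expg_mod_order.
elim: x => [|x IHx]; first by rewrite big_ord0 !expg0 perm1 mulg1 mul1g.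
rewrite big_ord_recr /= expgSr mulgA IHx -mulgA skew_piP // mulgA -expgD.
by rewrite permM.
Qed.

(** [t] sends the coset of [s ^+ x] modulo [<t>] to that of [s ^+ derived_fun n s x]; this is why
    the exponent [c] can be left unspecified. *)
Lemma derived_funP s (x : 'I_#[s]%g) : 0 < n -> skew_morphism s ->
  exists c, (t * s ^+ x = s ^+ derived_fun n s x * t ^+ c)%g.
Proof.
move=> n0 sk; rewrite /derived_fun /oneZ insubT ?ltn_pmod // => H1.
set one := Sub _ _; exists ((s ^+ x)%g one).
rewrite val_insubd /skew_sigma ltn_pmod ?order_gt0 // -/(skew_sigma s x one).
rewrite -skew_sigmaP //; congr (_ * _)%g.
by rewrite /one SubK translationX_mod expg1.
Qed.

(** The default branch of [derived] has to be excluded: if [x1] and [x2] have the same image, then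
    cancelling [t] puts [s ^+ x1] and [s ^+ x2] in one coset of [<t>]. *)
Lemma derived_commute s (x : 'I_#[s]%g) : 0 < n -> skew_morphism s ->
  exists c, (t * s ^+ x = s ^+ derived n s x * t ^+ c)%g.
Proof.
move=> n0 sk; rewrite /derived; case: injectiveP => [H|].
  by rewrite permE; apply: derived_funP.
case=> x1 x2 E; have [c Hc] := derived_funP x1 n0 sk.
have [c' Hc'] := derived_funP x2 n0 sk; apply/ord_inj.
(* [t ^+ (c * n.-1)] is the inverse of [t ^+ c], written with a natural exponent as [factor_uniq]
   requires. *)
have E1 : (s ^+ derived_fun n s x1 = t * s ^+ x1 * t ^+ (c * n.-1))%g.
  rewrite Hc -mulgA -expgD -mulnS prednK // mulnC expgM translation_order.
  by rewrite expg1n mulg1.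
have : (s ^+ x1 * t ^+ (c * n.-1) = s ^+ x2 * t ^+ (c' * n.-1))%g.
  apply: (mulgI t); rewrite !mulgA -E1 E Hc' -mulgA -expgD -mulnS prednK //.
  by rewrite mulnC expgM translation_order expg1n mulg1.
move/(factor_uniq n0 sk)/eqP; rewrite eq_expg_mod_order.
by rewrite !modn_small ?ltn_ord // => /eqP.
Qed.

Lemma derived_uniq s (x : 'I_#[s]%g) j c : 0 < n -> skew_morphism s ->
  (t * s ^+ x = s ^+ j * t ^+ c)%g -> nat_of_ord (derived n s x) = j %% #[s]%g.
Proof.
move=> n0 sk E; have [c' Hc'] := derived_commute x n0 sk.
move: E; rewrite Hc' => /(factor_uniq n0 sk)/eqP; rewrite eq_expg_mod_order.
by rewrite modn_small // => /eqP.
Qed.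

Lemma derived_commuteX s (x : 'I_#[s]%g) k : 0 < n -> skew_morphism s ->
  exists c, (t ^+ k * s ^+ x = s ^+ (derived n s ^+ k)%g x * t ^+ c)%g.
Proof.
move=> n0 sk; elim: k => [|k [c IHk]].
  by exists 0; rewrite !expg0 perm1 mulg1 mul1g.
have [c' Hc'] := derived_commute ((derived n s ^+ k)%g x) n0 sk; exists (c' + c).
by rewrite expgS -mulgA IHk mulgA Hc' -mulgA -expgD [in RHS]expgSr permM.
Qed.

Lemma derived_uniqX s (x : 'I_#[s]%g) k j c : 0 < n -> skew_morphism s ->
  (t ^+ k * s ^+ x = s ^+ j * t ^+ c)%g ->
  nat_of_ord ((derived n s ^+ k)%g x) = j %% #[s]%g.
Proof.
move=> n0 sk E; have [c' Hc'] := derived_commuteX x k n0 sk.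
move: E; rewrite Hc' => /(factor_uniq n0 sk)/eqP; rewrite eq_expg_mod_order.
by rewrite modn_small // => /eqP.
Qed.

Lemma derived_order_dvd s : 0 < n -> skew_morphism s -> #[derived n s]%g %| n.
Proof.
move=> n0 sk; rewrite order_dvdn; apply/eqP/permP => x; apply: ord_inj.
rewrite (@derived_uniqX s x n x 0) ?perm1 ?modn_small //.
by rewrite translation_order mulg1 mul1g.
Qed.

(** In [t * s ^+ (a + b)], moving [t] past [s ^+ a] leaves some [t ^+ c], which then acts on
    [s ^+ b] as [derived n s ^+ c]; so [c] is the required exponent. *)
Lemma derived_skew s : 0 < n -> skew_morphism s -> skew_morphism (derived n s).
Proof.
move=> n0 sk; split=> [a a0|a].
  apply: ord_inj; rewrite (@derived_uniq s a 0 1) ?a0 ?mod0n //.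
  by rewrite mulg1 mul1g.
have [c Hc] := derived_commute a n0 sk; exists c => b; apply: ord_inj.
have [c' Hc'] := derived_commuteX b c n0 sk.
rewrite val_insubd ltn_pmod ?order_gt0 //.
apply: (@derived_uniq _ _ _ c') => //.
rewrite val_insubd ltn_pmod ?order_gt0 // expg_mod_order !expgD mulgA Hc.
by rewrite -mulgA Hc' mulgA.
Qed.

(* <s ^+ x> and its conjugate by t are subgroups of the same order of the
   cyclic group <s>, so t normalises <s ^+ x>, which then fixes every point. *)
Lemma skew_stab1 s x (one : 'I_n) : one = 1 :> nat -> skew_morphism s ->
  (s ^+ x)%g one = one -> (s ^+ x = 1)%g.
Proof.
move=> v1 sk fix1; have [i Hi] := skew_commuteX sk x one.
move: Hi; rewrite fix1 v1 expg1 => Hi.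
have Ei : (s ^+ x ^ t^-1 = s ^+ i)%g.
  by rewrite conjgE invgK mulgA Hi mulgK.
have eqc : <[s ^+ x ^ t^-1]>%g = <[s ^+ x]>%g.
  apply/eqP; rewrite (eq_subG_cyclic (cycle_cyclic s)).
  - by rewrite -!orderE orderJ.
  - by rewrite Ei cycleX.
  - exact: cycleX.
have norm k y : y \in <[s ^+ x]>%g -> (y ^ (t^-1 ^+ k) \in <[s ^+ x]>)%g.
  elim: k y => [|k IHk] y Hy; first by rewrite expg0 conjg1.
  rewrite expgSr conjgM -eqc cycleJ memJ_conjg; exact: IHk.
apply/permP => b; rewrite perm1.
have := norm b _ (cycle_id (s ^+ x)%g); rewrite conjgE expgVn invgK => /cycleP[j].
rewrite -expgM => /(congr1 (fun f : {perm _} => f (zeroI b))).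
rewrite (@fix_zeroX s) ?(skew_zero b sk) // !permM.
have -> : (t ^+ b)%g (zeroI b) = b.
  by apply: ord_inj; rewrite val_translationX !val_zeroI add0n modn_small.
move/(congr1 (t ^+ b)%g); rewrite permKV => ->; apply: ord_inj.
by rewrite val_translationX !val_zeroI add0n modn_small.
Qed.

(** The orbit of 1 under [<s>] has [#[s]] elements, since the stabiliser of 1 is trivial, and it
    misses the fixed point 0. *)
Lemma skew_order_lt s : 1 < n -> skew_morphism s -> #[s]%g < n.
Proof.
move=> n1 sk; pose one : 'I_n := Ordinal n1.
pose f (x : 'I_#[s]%g) := (s ^+ x)%g one.
have injf : injective f.
  move=> x y; wlog le_xy : x y / x <= y.
    by move=> W E; case/orP: (leq_total x y) => le; [|apply/esym]; apply: W.
  rewrite /f -(subnK le_xy) expgD permM => /perm_inj E.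
  have /eqP := skew_stab1 (erefl : one = 1 :> nat) sk (esym E).
  rewrite -order_dvdn => /dvdn_leq; move: (ltn_ord x) (ltn_ord y) => *.
  by apply: ord_inj; lia.
rewrite -[#[s]%g]card_ord -(card_codom injf).
have : codom f \subset predC1 (zeroI one).
  apply/subsetP => _ /codomP[x ->]; rewrite inE; apply/eqP => E.
  have : one = zeroI one.
    by apply: (@perm_inj _ (s ^+ x)%g); rewrite (@fix_zeroX s) // (skew_zero one).
  by move/(congr1 (@nat_of_ord _)); rewrite val_zeroI.
move/subset_leq_card => H; apply: leq_ltn_trans H _.
by rewrite cardC1 card_ord prednK // ltnW.
Qed.

End Translation.

(** * Integers congruent to 1 modulo an odd prime, and their powers *)

Section PrincipalUnits.
Local Open Scope ring_scope.
Local Notation "d %|z x" := (x \in dvdz d) (at level 70).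

Lemma dvdz_mulC (m x : int) : (m %|z m * x).
Proof. exact: dvdz_mulr. Qed.

Lemma dvdz_lin2 (m x y a b : int) : (m %|z x) -> (m %|z y) -> (m %|z a * x + b * y).
Proof. by move=> Hx Hy; rewrite rpredD // dvdz_mull. Qed.

(** Used with [dvdz_lin2] to turn a congruence into a ring identity: known multiples of [m] are
    combined with explicit coefficients and [ring] compares the result with the goal. *)
Lemma dvdz_congr (m x y : int) : (m %|z x) -> y = x -> (m %|z y).
Proof. by move=> ? ->. Qed.

Lemma expr_sub1_dvd (m x : int) k : (m %|z x - 1) -> (m %|z x ^+ k - 1).
Proof. by move=> H; rewrite subrX1 dvdz_mulr. Qed.

Lemma expr1D_mod2 (x : int) n : exists y : int, (1 + x) ^+ n = 1 + n%:Z * x + x ^+ 2 * y.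
Proof.
elim: n => [|n [y IH]]; first by exists 0; ring.
by exists (n%:Z + y * (1 + x)); rewrite exprS IH -[n.+1]addn1 PoszD; ring.
Qed.

Lemma expr1D_mod3 (x : int) n :
  exists y : int, (1 + x) ^+ n = 1 + n%:Z * x + 'C(n, 2)%:Z * x ^+ 2 + x ^+ 3 * y.
Proof.
elim: n => [|n [y IH]]; first by exists 0; rewrite bin0n /=; ring.
exists ('C(n, 2)%:Z + y * (1 + x)).
by rewrite exprS IH binS bin1 -[n.+1]addn1 !PoszD; ring.
Qed.

Variable p : nat.
Hypotheses (p_pr : prime p) (p_odd : odd p).
Local Notation P := (p%:Z).

Lemma prime_ndvd_coprimez (a : int) : ~~ (P %|z a) -> coprimez P a.
Proof. by rewrite dvdzE coprimezE /= prime_coprime. Qed.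

(** Two bases [r] occur later: [q], with [c0 = 1], and [g ^+ 2], with [c0 = P - 2]. *)
Variable c0 : int.
Hypothesis c0P : ~~ (P %|z c0).
Local Notation r := (1 + P * c0).

(** In the [p]-th power of [1 + P ^+ k.+1 * c] the linear term is [P ^+ k.+2 * c]. The quadratic
    term is divisible by [P ^+ k.+3] because an odd [p] divides ['C(p, 2)], and so is the cubic
    remainder. *)
Lemma principal_expp k : exists2 c : int, r ^+ (p ^ k) = 1 + P ^+ k.+1 * c & ~~ (P %|z c).
Proof.
elim: k => [|k [c IH Hc]]; first by exists c0; rewrite // expr1.
have p2 : (2 < p)%N by case: p p_pr p_odd => [|[|[|]]].
have /dvdnP[b Hb] : (p %| 'C(p, 2))%N by rewrite prime_dvd_bin.
have [y Hy] := expr1D_mod3 (P ^+ k.+1 * c) p.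
rewrite expnSr exprM IH Hy Hb PoszM.
exists (c + P * (b%:Z * P ^+ k * c ^+ 2 + P ^+ k * P ^+ k * c ^+ 3 * y)).
  by rewrite !exprS; ring.
by apply: contra Hc; rewrite rpredDr ?dvdz_mulC.
Qed.

(** By induction [d = d' * p ^ k], and then [r ^+ d - 1] is [P ^+ k.+1] times [d' * c] plus a
    multiple of [P]; as [c] is prime to [p], [p] divides [d']. *)
Lemma expr_principal_dvd k d : (P ^+ k.+1 %|z r ^+ d - 1) -> (p ^ k %| d)%N.
Proof.
elim: k d => [|k IHk] d H; first exact: dvd1n.
have /IHk/dvdnP[d' Ed] : (P ^+ k.+1 %|z r ^+ d - 1).
  by apply: dvdz_trans H; rewrite exprSr dvdz_mulr.
have [c Ec Hc] := principal_expp k; have [y Hy] := expr1D_mod2 (P ^+ k.+1 * c) d'.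
move: H; rewrite Ed mulnC exprM Ec Hy.
have -> : 1 + d'%:Z * (P ^+ k.+1 * c) + (P ^+ k.+1 * c) ^+ 2 * y - 1
   = P ^+ k.+1 * (d'%:Z * c + P * (P ^+ k * c ^+ 2 * y)) by rewrite !exprS; ring.
have Pn0 : P != 0 by rewrite eqz_nat -lt0n prime_gt0.
rewrite [P ^+ k.+2]exprSr dvdz_mul2l ?expf_neq0 //= rpredDr ?dvdz_mulC //.
rewrite Gauss_dvdzl ?prime_ndvd_coprimez // dvdzE /= => /dvdnP[w ->].
by rewrite mulnCA -expnSr dvdn_mull.
Qed.

Lemma affine_root_modp (a w : int) : ~~ (P %|z a) -> exists t : nat, (P %|z w + a * t%:Z).
Proof.
move=> /prime_ndvd_coprimez /eqP Ha; have [x [y E]] := Bezoutz P a; rewrite Ha in E.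
(* [y] inverts [a] modulo [p]; the reduction modulo [P] makes the root a natural number. *)
exists `|(- w * y %% P)%Z|%N.
have Pn0 : P != 0 by rewrite eqz_nat -lt0n prime_gt0.
rewrite gez0_abs ?modz_ge0 // /modz.
move: (_ %/ _)%Z => d.
have -> : w + a * (- w * y - d * P) = P * (w * x - a * d) + w * (1 - (x * P + y * a)).
  by ring.
by rewrite E subrr mulr0 addr0 dvdz_mulC.
Qed.

(** Discrete logarithm of [u / v] to base [r], lifted one power of [p] at a time: adding [p ^ k * t]
    to [j] changes [r ^+ j * v] by [P ^+ k.+1 * (r ^+ j * v * c * t)] modulo [P ^+ k.+2], and [t] is
    chosen to cancel the error [w]. *)
Lemma principal_log k (u v : int) : (P %|z u - 1) -> (P %|z v - 1) ->
  exists j, (P ^+ k.+1 %|z r ^+ j * v - u).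
Proof.
move=> Hu Hv; elim: k => [|k [j /dvdzP[w Hw]]].
  exists 0%N; rewrite expr0 expr1 mul1r.
  by apply: dvdz_congr (rpredB Hv Hu) _; ring.
have [c Ec Hc] := principal_expp k.
have Hr : (P %|z r ^+ j * v - 1).
  rewrite (_ : _ - 1 = (r ^+ j - 1) * v + (v - 1)); last by ring.
  rewrite rpredD ?dvdz_mulr ?expr_sub1_dvd //.
  by rewrite (_ : r - 1 = P * c0) ?dvdz_mulC //; ring.
have Ha : ~~ (P %|z r ^+ j * v * c).
  apply: contra Hc; rewrite (_ : r ^+ j * v * c = (r ^+ j * v - 1) * c + c); last by ring.
  by rewrite rpredDl // dvdz_mulr.
have [t Ht] := affine_root_modp w Ha; exists (j + p ^ k * t)%N.
have [y Hy] := expr1D_mod2 (P ^+ k.+1 * c) t.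
rewrite exprD exprM Ec Hy.
rewrite (_ : _ - u = (r ^+ j * v - u) + P ^+ k.+1 * (r ^+ j * v * c * t%:Z
   + P * (r ^+ j * v * P ^+ k * c ^+ 2 * y))); last by rewrite !exprS; ring.
rewrite Hw [w * _]mulrC -mulrDr [P ^+ k.+2]exprSr; apply: dvdz_mul; first exact: dvdzz.
by rewrite addrA; apply: rpredD => //; apply: dvdz_mulC.
Qed.

End PrincipalUnits.

(** * A family of skew morphisms stable under double derivation *)

Section Witness.
Local Open Scope ring_scope.
Local Notation "d %|z x" := (x \in dvdz d) (at level 70).

Variable p : nat.
Hypotheses (p_pr : prime p) (p_odd : odd p).
Local Notation P := (p%:Z).
Local Notation q := (1 + P).
Local Notation g := (P - 1).

(** The [i]-th iterate of [z |-> q z + 1] sends 0 to [(q ^+ i - 1) / P], and [s] multiplies this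
    point of Z/p^k by [g]. Clearing the denominator raises the modulus to [P ^+ k.+1]. The size is
    constrained by an equation because derived morphisms live on ['I_#[_]]. *)
Definition affine_coordinate k n (s : {perm 'I_n}) :=
  n = (p ^ k)%N /\
  forall i : 'I_n, (P ^+ k.+1 %|z q ^+ s i - (1 + g * (q ^+ i - 1))).

Lemma p_ndvd1 : ~~ (P %|z 1).
Proof. by rewrite dvdz1 /= neq_ltn prime_gt1 ?orbT. Qed.

Lemma dvdz_pexp k (x : int) : (P ^+ k.+1 %|z x) -> (P %|z x).
Proof. by apply: dvdz_trans; rewrite exprS dvdz_mulr. Qed.

Lemma unit_cancel k (u x : int) :
  ~~ (P %|z u) -> (P ^+ k %|z u * x) -> (P ^+ k %|z x).
Proof.
by move=> Hu; rewrite Gauss_dvdzr // coprimezXl ?prime_ndvd_coprimez.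
Qed.

Lemma p_cancel k (x : int) : P ^+ k.+1 %|z P * x -> P ^+ k %|z x.
Proof. by rewrite exprS dvdz_mul2l // eqz_nat -lt0n prime_gt0. Qed.

Lemma q1E : q = 1 + P * 1. Proof. by rewrite mulr1. Qed.
Lemma g2E : g ^+ 2 = 1 + P * (P - 2). Proof. by ring. Qed.

Lemma p_ndvd2 : ~~ (P %|z P - 2).
Proof.
rewrite rpredDl ?dvdzz // rpredN dvdzE /=; apply/negP => /dvdn_leq.
by case: p p_pr p_odd => [|[|[|m]]] //= _ _ /(_ isT).
Qed.

Lemma q_sub1 i : (P %|z q ^+ i - 1).
Proof. by apply: expr_sub1_dvd; rewrite (_ : _ - 1 = P) ?dvdzz //; ring. Qed.

Lemma p_ndvd_sub1 (u : int) : (P %|z u - 1) -> ~~ (P %|z u).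
Proof.
move=> H; apply: contra p_ndvd1 => Hu.
by apply: dvdz_congr (rpredB Hu H) _; ring.
Qed.

Lemma p_ndvd_g i : ~~ (P %|z g ^+ i).
Proof.
apply/negP => H; have : (P %|z (g ^+ i) ^+ 2) by rewrite dvdz_mulr.
rewrite -exprM mulnC exprM; apply/negP/p_ndvd_sub1/expr_sub1_dvd.
by rewrite g2E (_ : _ - 1 = P * (P - 2)) ?dvdz_mulC //; ring.
Qed.

Lemma p_ndvd_1subg : ~~ (P %|z 1 - g).
Proof.
apply: contra p_ndvd2; rewrite (_ : 1 - g = - (P - 2)); last by ring.
by rewrite rpredN.
Qed.

Lemma q_order k : (P ^+ k.+1 %|z q ^+ (p ^ k) - 1).
Proof.
have := principal_expp p_pr p_odd p_ndvd1 k; rewrite -q1E => -[c -> _].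
by rewrite (_ : _ - 1 = P ^+ k.+1 * c) ?dvdz_mulC //; ring.
Qed.

Lemma q_mod k j : (P ^+ k.+1 %|z q ^+ (j %% p ^ k) - q ^+ j).
Proof.
rewrite {2}(divn_eq j (p ^ k)) exprD mulnC exprM.
have := expr_sub1_dvd (j %/ p ^ k) (q_order k).
set a := _ ^+ (j %/ _); set b := q ^+ _ => H.
by rewrite (_ : _ - _ = (a - 1) * - b) ?dvdz_mulr //; ring.
Qed.

(** A quotient of the two powers equal to 1 modulo [P ^+ k.+1] has exponent divisible by [p ^ k];
    hence [q ^+ i] is a faithful coordinate on Z_{p^k}. *)
Lemma q_inj k i j : (i < p ^ k)%N -> (j < p ^ k)%N ->
  (P ^+ k.+1 %|z q ^+ i - q ^+ j) -> i = j.
Proof.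
wlog le_ij : i j / (i <= j)%N.
  move=> W Hi Hj H; case/orP: (leq_total i j) => le; first exact: W.
  by apply/esym/W; rewrite // -opprB rpredN.
move=> Hi Hj; rewrite -{1}(subnKC le_ij) exprD.
rewrite (_ : _ - _ = q ^+ i * - (q ^+ (j - i) - 1)); last by ring.
move/(unit_cancel (p_ndvd_sub1 (q_sub1 i))); rewrite rpredN q1E.
move/(expr_principal_dvd p_pr p_odd p_ndvd1)/dvdn_leq; lia.
Qed.

Section Coordinate.
Variables (k n : nat) (s : {perm 'I_n}).
Hypothesis s_coord : affine_coordinate k s.

Lemma coordinateX j (i : 'I_n) :
  (P ^+ k.+1 %|z q ^+ (s ^+ j)%g i - (1 + g ^+ j * (q ^+ i - 1))).
Proof.
elim: j => [|j IHj]; first by apply: dvdz_congr (dvdz0 _) _; rewrite expg0 perm1 expr0; ring.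
rewrite expgSr permM; have := (s_coord.2 ((s ^+ j)%g i)).
move: IHj; set x := q ^+ _; set y := q ^+ s _; set z := q ^+ i => H1 H2.
apply: dvdz_congr (dvdz_lin2 g 1 H1 H2) _.
by rewrite exprSr; ring.
Qed.

Lemma coordinate_eq (x y : 'I_n) : (P ^+ k.+1 %|z q ^+ x - q ^+ y) -> x = y.
Proof.
by move=> H; apply: ord_inj; apply: q_inj H; have := s_coord.1 => <-.
Qed.

Lemma coordinate_mod j : (P ^+ k.+1 %|z q ^+ (j %% n) - q ^+ j).
Proof. by rewrite s_coord.1 q_mod. Qed.

Lemma coordinate_add (a b : 'I_n) : (P ^+ k.+1 %|z q ^+ addI a b - q ^+ a * q ^+ b).
Proof. by rewrite val_addI -exprD coordinate_mod. Qed.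

(** Write [A], [B], [SA] for the coordinates of [a], [b], [s a]. Then [a + b] is sent to
    [SA + g A (B - 1)], which must equal [SA (1 + g^i (B - 1))]. So [g^(i-1)] should be [A / SA],
    which is 1 modulo [p] and hence a power of [g^2]; this makes [i] odd. *)
Lemma coordinate_skew : skew_morphism s.
Proof.
split=> [a a0|a].
  apply: coordinate_eq; have := s_coord.2 a.
  by rewrite /= in a0; rewrite a0 expr0 subrr mulr0 addr0.
have Hu := q_sub1 a.
have Hv : (P %|z (1 + g * (q ^+ a - 1)) - 1).
  by rewrite addrAC subrr add0r dvdz_mull.
have [j] := principal_log p_pr p_odd p_ndvd2 k Hu Hv.
rewrite -g2E -exprM => Hj.
exists (2 * j).+1 => b; apply: coordinate_eq.
have H1 := coordinate_add a b.
have H2 := coordinate_add (s a) ((s ^+ (2 * j).+1)%g b).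
have H3 := s_coord.2 (addI a b).
have H4 := coordinateX (2 * j).+1 b.
have H5 := s_coord.2 a.
move: H1 H2 H3 H4 H5 Hj; rewrite [g ^+ (2 * j).+1]exprS.
move: (q ^+ addI a b) (q ^+ s (addI a b)) (q ^+ addI (s a) _) => AB X Y.
move: (q ^+ (s ^+ (2 * j).+1)%g b) (g ^+ (2 * j)) => SB G.
move: (q ^+ a) (q ^+ b) (q ^+ s a) => A B SA.
move=> H1 H2 H3 H4 H5 Hj.
apply: dvdz_congr (dvdz_lin2 1 (- 1) (dvdz_lin2 1 g H3 H1)
  (dvdz_lin2 1 1 (dvdz_lin2 1 SA H2 H4)
    (dvdz_lin2 (1 + g * G * (B - 1)) (g * (B - 1)) H5 Hj))) _.
by ring.
Qed.

End Coordinate.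

(** Values come from the logarithm to base [q]; injectivity holds because [g] is a unit modulo
    [p]. *)
Lemma affine_coordinate_exists k :
  exists s : {perm 'I_(p ^ k)}, affine_coordinate k s.
Proof.
have n0 : (0 < p ^ k)%N by rewrite expn_gt0 prime_gt0.
have ex (i : 'I_(p ^ k)) :
    exists j : 'I_(p ^ k), P ^+ k.+1 %|z q ^+ j - (1 + g * (q ^+ i - 1)).
  have Hu : P %|z (1 + g * (q ^+ i - 1)) - 1.
    by rewrite addrAC subrr add0r dvdz_mull ?q_sub1.
  have H1 : P %|z 1 - 1 by rewrite subrr dvdz0.
  have [j] := principal_log p_pr p_odd p_ndvd1 k Hu H1.
  rewrite -q1E => Hj; exists (Ordinal (ltn_pmod j n0)).
  by apply: dvdz_congr (rpredD (q_mod k j) Hj) _ => /=; ring.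
have [f Hf] := fin_all_exists ex.
have f_inj : injective f.
  move=> i j E; apply/ord_inj/(@q_inj k) => //.
  apply: (@unit_cancel _ g); first exact: (p_ndvd_g 1).
  have := Hf i; rewrite E => Hi.
  by apply: dvdz_congr (rpredB (Hf j) Hi) _; ring.
by exists (perm f_inj); split=> // i; rewrite permE.
Qed.

(* In the coordinate u = g^-x the derived morphism is u - 1 |-> (u - 1)/q. *)
Lemma derived_coordinate k n (s : {perm 'I_n}) j (x : 'I_#[s]%g) :
  (0 < k)%N -> affine_coordinate k s ->
  P ^+ k %|z g ^+ x * q ^+ j -
             g ^+ (derived n s ^+ j)%g x * (1 + g ^+ x * (q ^+ j - 1)).
Proof.
move=> k0 sc; have sk := coordinate_skew sc.
have n1 : (1 < n)%N by rewrite sc.1 -{1}(expn0 p) ltn_exp2l ?prime_gt1.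
have n0 := ltnW n1.
(* This is the case [j = 1]. The commutation rule at 0 determines [q ^+ c]; substituted into the
   rule at 1, it leaves a multiple of [P], whose cancellation lowers the modulus to [P ^+ k]. *)
have step (y : 'I_#[s]%g) : P ^+ k %|z g ^+ y * q - g ^+ derived n s y * (1 + P * g ^+ y).
  have [c /permP Hc] := derived_commute y n0 sk.
  pose b0 := Ordinal n0; pose b1 := Ordinal n1.
  have := Hc b0; have := Hc b1; rewrite !permM.
  move=> /(congr1 (fun i : 'I_n => q ^+ i)) E1 /(congr1 (fun i : 'I_n => q ^+ i)) E0.
  rewrite val_translationX in E1; rewrite val_translationX in E0.
  have M1 := coordinate_mod sc ((s ^+ derived n s y)%g b1 + c).
  have M0 := coordinate_mod sc ((s ^+ derived n s y)%g b0 + c).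
  rewrite -E1 exprD in M1; rewrite -E0 exprD in M0.
  have X1 := coordinateX sc (derived n s y) b1.
  have X0 := coordinateX sc (derived n s y) b0.
  have Y1 := coordinateX sc y (translation n b1).
  have Y0 := coordinateX sc y (translation n b0).
  have T (b : 'I_n) : P ^+ k.+1 %|z q ^+ translation n b - q ^+ b.+1.
    by have := coordinate_mod sc (b + 1); rewrite -val_translationX expg1 addn1.
  have T1 := T b1; have T0 := T b0.
  apply: p_cancel.
  move: M1 M0 X1 X0 Y1 Y0 T1 T0; rewrite /= expr0 expr1.
  move: (q ^+ translation n b1) (q ^+ translation n b0) => t1 t0.
  move: (q ^+ (s ^+ y)%g _) (q ^+ (s ^+ y)%g _) => R0 R1.
  move: (q ^+ (s ^+ _)%g b1) (q ^+ (s ^+ _)%g b0) (q ^+ c) => S1 S0 C.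
  move: (g ^+ y) (g ^+ _) => V W M1 M0 X1 X0 Y1 Y0 T1 T0.
  have F0 := dvdz_lin2 1 (- (1 : int)) (dvdz_lin2 1 V Y0 T0) (dvdz_lin2 1 C M0 X0).
  have F1 := dvdz_lin2 1 (- (1 : int)) (dvdz_lin2 1 V Y1 T1) (dvdz_lin2 1 C M1 X1).
  apply: dvdz_congr (dvdz_lin2 (1 + W * P) (- (1 : int)) F0 F1) _.
  by ring.
elim: j => [|j IHj].
  by apply: dvdz_congr (dvdz0 _) _; rewrite expg0 perm1 expr0; ring.
have := step ((derived n s ^+ j)%g x); rewrite expgSr permM.
move: ((derived n s ^+ j)%g x) IHj => y; rewrite exprSr.
move: (g ^+ x) (q ^+ j) (g ^+ y) (g ^+ derived n s y) => X J Y Z H1 H2.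
apply: dvdz_congr (dvdz_lin2 (q - Z * P) (1 + X * (J - 1)) H1 H2) _.
by ring.
Qed.

Lemma coordinate_card_gt1 k n (s : {perm 'I_n}) :
  affine_coordinate k.+1 s -> (1 < n)%N.
Proof. by move=> sc; rewrite sc.1 -{1}(expn0 p) ltn_exp2l ?prime_gt1. Qed.

Lemma coordinate_order_gt1 k n (s : {perm 'I_n}) :
  affine_coordinate k.+1 s -> (1 < #[s]%g)%N.
Proof.
move=> sc; rewrite ltn_neqAle order_gt0 andbT eq_sym order_eq1.
apply/eqP => s1; have n1 := coordinate_card_gt1 sc; have := sc.2 (Ordinal n1).
rewrite s1 perm1 /= expr1 => H; case/negP: p_ndvd_1subg.
by apply/(@dvdz_pexp k)/p_cancel/(dvdz_congr H); ring.
Qed.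

(** Evaluating [s ^+ #[s] = 1] at the point 1 shows that [g ^+ #[s]] is 1 modulo [P ^+ k.+1]; one
    power of [p] is spent on [q - 1 = P]. *)
Lemma g_mod k n (s : {perm 'I_n}) j :
  affine_coordinate k.+1 s -> P ^+ k.+1 %|z g ^+ (j %% #[s]%g) - g ^+ j.
Proof.
move=> sc; have Hm : P ^+ k.+1 %|z g ^+ #[s]%g - 1.
  have := coordinateX sc #[s]%g (Ordinal (coordinate_card_gt1 sc)).
  rewrite expg_order perm1 /= expr1; move: (g ^+ _) => G H; apply: p_cancel.
  by apply: dvdz_congr (dvdz_lin2 (- (1 : int)) 0 H H) _; ring.
rewrite {2}(divn_eq j #[s]%g) exprD mulnC exprM.
have := expr_sub1_dvd (j %/ #[s]%g) Hm.
set a := _ ^+ (j %/ _); set b := g ^+ _ => H.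
by apply: dvdz_congr (dvdz_lin2 (- b) 0 H H) _; ring.
Qed.

(** The order divides [p ^ k.+1] and is smaller, so it divides [p ^ k]. Conversely its vanishing
    power, evaluated at [x = 1] in [derived_coordinate], forces [q ^+ #[d]] to be 1 modulo
    [P ^+ k.+1]. *)
Lemma derived_order k n (s : {perm 'I_n}) :
  affine_coordinate k.+1 s -> #[derived n s]%g = (p ^ k)%N.
Proof.
move=> sc; have sk := coordinate_skew sc.
have n1 := coordinate_card_gt1 sc; have n0 := ltnW n1.
have m1 := coordinate_order_gt1 sc.
set d := derived n s.
have d_lt : (#[d]%g < p ^ k.+1)%N.
  rewrite -sc.1; apply: ltn_trans (skew_order_lt n1 sk).
  exact/skew_order_lt/derived_skew.
have : (#[d]%g %| p ^ k.+1)%N by rewrite -sc.1 derived_order_dvd.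
case/(dvdn_pfactor _ _ p_pr) => i _ Ei.
have le_ik : (i <= k)%N.
  by move: d_lt; rewrite Ei ltn_exp2l ?prime_gt1 // ltnS.
have := derived_coordinate #[d]%g (Ordinal m1) (ltn0Sn k) sc.
rewrite -/d expg_order perm1 /= expr1; set J := q ^+ _ => H.
have : P ^+ k.+1 %|z g * ((1 - g) * (J - 1)).
  by apply: dvdz_congr H _; ring.
move/(unit_cancel (p_ndvd_g 1))/(unit_cancel p_ndvd_1subg).
rewrite /J q1E => /(expr_principal_dvd p_pr p_odd p_ndvd1).
rewrite Ei dvdn_Pexp2l ?prime_gt1 // => le_ki.
by congr (_ ^ _)%N; apply/eqP; rewrite eqn_leq le_ik.
Qed.

(** The commutation rule [t * d ^+ y = d ^+ z * t ^+ c] is evaluated at 0 and 1, and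
    [derived_coordinate] expresses the points involved through [J = q ^+ y] and [Z = q ^+ z].
    Eliminating [C = g ^+ c] leaves [Z = 1 + g (J - 1)]. *)
Lemma derived2_coordinate k n (s : {perm 'I_n}) :
  affine_coordinate k.+1 s ->
  affine_coordinate k (derived _ (derived n s)).
Proof.
move=> sc; split=> [|y]; first exact: derived_order.
have sk := coordinate_skew sc; have n0 := ltnW (coordinate_card_gt1 sc).
have m1 := coordinate_order_gt1 sc; have m0 := ltnW m1.
have dsk := derived_skew n0 sk.
have [c /permP Hc] := derived_commute y m0 dsk.
set z := derived _ _ y in Hc *; set d := derived n s in y z Hc dsk *.
pose b0 := Ordinal m0; pose b1 := Ordinal m1.
have shift b : P ^+ k.+1 %|z g ^+ (d ^+ y)%g (translation _ b) - g ^+ (d ^+ z)%g b * g ^+ c.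
  have := Hc b; rewrite !permM => ->.
  by rewrite val_translationX -exprD g_mod.
have succ b : P ^+ k.+1 %|z g ^+ translation #[s]%g b - g ^+ b.+1.
  by have := g_mod (b + 1) sc; rewrite -val_translationX expg1 addn1.
have M1 := shift b0; have M2 := shift b1; have T1 := succ b0; have T2 := succ b1.
have A1 := derived_coordinate y (translation _ b0) (ltn0Sn k) sc.
have A2 := derived_coordinate y (translation _ b1) (ltn0Sn k) sc.
have B0 := derived_coordinate z b0 (ltn0Sn k) sc.
have B1 := derived_coordinate z b1 (ltn0Sn k) sc.
have Cu := p_ndvd_g c; have Ju := p_ndvd_sub1 (q_sub1 z).
move: M1 M2 T1 T2 A1 A2 B0 B1 Cu Ju; rewrite -/d /= expr0 expr1.
move: (g ^+ (d ^+ y)%g _) (g ^+ (d ^+ y)%g _) => R2 R1.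
move: (g ^+ translation _ _) (g ^+ translation _ _) => t2 t1.
move: (g ^+ (d ^+ z)%g b0) (g ^+ (d ^+ z)%g b1) (g ^+ c) (q ^+ y) (q ^+ z) => S0 S1 C J Z.
move=> M1 M2 T1 T2 A1 A2 B0 B1 Cu Zu.
have S0E : P ^+ k.+1 %|z 1 - S0.
  by apply: (unit_cancel Zu); apply: dvdz_congr B0 _; ring.
(* Since [R1 = C] and [R2 = S1 * C], this is the formula for [S1 = R2 / R1], multiplied out. *)
have F : P ^+ k.+1 %|z S1 * (1 + g ^+ 2 * (J - 1)) - g * (1 + g * (J - 1)).
  apply: (unit_cancel Cu).
  have E1 := dvdz_lin2 1 (- (J - R1 * (J - 1))) A1 T1.
  have E2 := dvdz_lin2 1 (- (J - R2 * (J - 1))) A2 T2.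
  have E3 := dvdz_lin2 1 (- C) M1 S0E.
  have E4 := dvdz_lin2 1 (1 + g * (J - 1)) E1 E3.
  have E5 := dvdz_lin2 1 (1 + g ^+ 2 * (J - 1)) E2 M2.
  by apply: dvdz_congr (dvdz_lin2 g (- (1 : int)) E4 E5) _; ring.
(* Comparing [F] with the value of [S1] in terms of [Z] gives the goal times [g * (1 - g)]. *)
apply: (unit_cancel p_ndvd_1subg); apply: (unit_cancel (p_ndvd_g 1)).
apply: dvdz_congr (dvdz_lin2 (1 + g ^+ 2 * (J - 1)) (1 - g + g * Z) B1 F) _.
by ring.
Qed.

End Witness.

(** * Sizes of the iterated derived groups and the complexity bound *)

Local Notation size_at s i := (projT1 (iter_derived s i)).

Lemma iter_derived_skew n (s : {perm 'I_n}) i : 0 < n -> skew_morphism s ->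
  0 < size_at s i /\ skew_morphism (projT2 (iter_derived s i)).
Proof.
move=> n0 sk; elim: i => [|i [IH0 IHs]]; first by split.
by rewrite /iter_derived iterS /=; split; [apply: order_gt0 | apply: derived_skew].
Qed.

Lemma perm_ord_le1 m (r : {perm 'I_m}) : m <= 1 -> r = 1%g.
Proof.
move=> m1; apply/permP => x; apply: ord_inj; rewrite perm1.
have /eqP -> : nat_of_ord x == 0 by rewrite -leqn0 -ltnS (leq_trans (ltn_ord x)).
by apply/eqP; rewrite -leqn0 -ltnS (leq_trans (ltn_ord _)).
Qed.

Lemma derived_order_lt n (s : {perm 'I_n}) : 1 < n -> skew_morphism s ->
  #[derived n s]%g < n.
Proof.
move=> n1 sk; have dsk := derived_skew (ltnW n1) sk.
apply: leq_ltn_trans (skew_order_lt n1 sk).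
have := order_gt0 s; rewrite leq_eqVlt => /orP[/eqP m1|m1]; last exact/ltnW/skew_order_lt.
by rewrite (perm_ord_le1 (derived n s)) ?order1 -?m1.
Qed.

(** Two derivations replace the size by a divisor, which is proper unless the size is already 1;
    among powers of [p] the exponent therefore drops. *)
Lemma iter_derived_dvd p e (s : {perm 'I_(p ^ e)}) i : prime p -> skew_morphism s ->
  i <= e -> size_at s (2 * i) %| p ^ (e - i).
Proof.
move=> p_pr sk; have n0 : 0 < p ^ e by rewrite expn_gt0 prime_gt0.
elim: i => [|i IHi] lt_ie; first by rewrite subn0.
have := IHi (ltnW lt_ie); have [x0 xsk] := iter_derived_skew (2 * i) n0 sk.
rewrite mulnS /iter_derived /= -/(iter_derived s (2 * i)).
move: (iter_derived s (2 * i)) x0 xsk => [n r] /= x0 rsk Hn.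
have Hd := derived_order_dvd x0 rsk.
have /(dvdn_pfactor _ _ p_pr)[j Hj Ej] := dvdn_trans Hd Hn.
rewrite Ej dvdn_Pexp2l ?prime_gt1 //.
move: Hn => /(dvdn_pfactor _ _ p_pr)[l Hl El].
case: (ltnP 1 n) => n1.
  have := derived_order_lt n1 rsk; rewrite Ej El ltn_exp2l ?prime_gt1 //.
  by lia.
have n_eq1 : n = 1 by apply/eqP; rewrite eqn_leq n1.
move: Hd; rewrite Ej {1}n_eq1 dvdn1 => /eqP.
by case: j {Hj Ej} => [|j] // H; have := ltn_exp2l 0 j.+1 (prime_gt1 p_pr); rewrite H.
Qed.

Theorem theorem6p2 (p e : nat) :
  prime p -> odd p -> 0 < e ->
  (forall s : {perm 'I_(p ^ e)}, skew_morphism s ->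
     exists2 c : nat, complexity s c & c <= 2 * e - 1) /\
  (exists2 s : {perm 'I_(p ^ e)}, skew_morphism s & complexity s (2 * e - 1)).
Proof.
move=> p_pr p_odd e0; have n0 : 0 < p ^ e by rewrite expn_gt0 prime_gt0.
have size_2e (s : {perm 'I_(p ^ e)}) : skew_morphism s -> size_at s (2 * e) = 1.
  move=> sk; have := iter_derived_dvd p_pr sk (leqnn e).
  by rewrite subnn dvdn1 => /eqP.
split=> [s sk|].
  (* The complexity is the predecessor of the first index of size 1; that index is not 0 because
     [e > 0]. *)
  have ex : exists i, size_at s i == 1 by exists (2 * e); rewrite size_2e.
  case: (ex_minnP ex) => -[|c] /eqP size_c min_c.
    by move: size_c => /= /eqP; rewrite -(expn0 p) eqn_exp2l ?prime_gt1 //; lia.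
  exists c; last by have := min_c (2 * e); rewrite size_2e // eqxx => /(_ isT); lia.
  split=> //; have [c0 _] := iter_derived_skew c n0 sk.
  rewrite ltn_neqAle c0 andbT; apply/eqP => c1.
  by have := min_c c; rewrite -c1 eqxx ltnn => /(_ isT).
have [s sc] := affine_coordinate_exists p_pr p_odd e.
have sk := coordinate_skew p_pr p_odd sc; exists s => //.
have coord i : i <= e ->
    affine_coordinate p (e - i) (projT2 (iter_derived s (2 * i))).
  elim: i => [|i IHi] lt_ie; first by rewrite subn0.
  have := IHi (ltnW lt_ie); rewrite mulnS /iter_derived /= -/(iter_derived s (2 * i)).
  have -> : e - i = (e - i.+1).+1 by lia.
  exact: derived2_coordinate.
(* After [2 * e.-1] derivations the coordinate has exponent 1, so the morphism is still non-trivial;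
   its order is the size at the next index. *)
have E : 2 * e - 1 = (2 * e.-1).+1 by lia.
split; last by rewrite E (_ : (2 * e.-1).+2 = 2 * e) ?size_2e //; lia.
rewrite E /iter_derived iterS -/(iter_derived s _).
have := coord e.-1 (leq_pred e); rewrite (_ : e - e.-1 = 1); last by lia.
exact: coordinate_order_gt1.
Qed.
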